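(* Let $P_1$ be the uniform distribution on $[0,\frac12]$, let $P_2$ be the discrete distribution with mass $\frac13$ at each point of $D=\{\frac23,\frac56,1\}$, and let $P=\frac12P_1+\frac12P_2$. Let $\alpha$ be an optimal set of five-means for $P$. Then $\alpha=\{\frac18,\frac38,\frac23,\frac56,1\}$, and the corresponding quantization error is $V_5(P)=\frac1{384}$.
   Context: For a Borel probability measure $Q$ on $\mathbb R$ with finite second moment and a finite nonempty set $\alpha\subset\mathbb R$, put $V(Q;\alpha)=\int\min_{a\in\alpha}(x-a)^2\,dQ(x)$ and $V_n(Q)=\inf\{V(Q;\alpha):\alpha\subset\mathbb R,\ 1\le\mathrm{card}(\alpha)\le n\}$ (the $n$th quantization error). A set $\alpha$ with $1\le\mathrm{card}(\alpha)\le n$ is an optimal set of $n$-means for $Q$ if $V(Q;\alpha)=V_n(Q)$; ''five-means'' is the case $n=5$. *)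

(* Defs.v *)
From HB Require Import structures.
From mathcomp Require Import all_boot all_order all_algebra finmap.
From mathcomp Require Import all_classical all_reals all_analysis.

Set Implicit Arguments.
Unset Strict Implicit.
Unset Printing Implicit Defensive.

Import Order.TTheory GRing.Theory Num.Theory.
Import numFieldNormedType.Exports.

Local Open Scope classical_set_scope.
Local Open Scope fset_scope.
Local Open Scope ring_scope.

Section quantization.
Local Open Scope ereal_scope.
Context {R : realType}.
Implicit Types (Q : probability (measurableTypeR R) R) (alpha : {fset R}).

(* The neutral element +oo makes the iterated minimum the usual one as soon as
   alpha is nonempty, which is always required below. *)
Definition sq_dist alpha (x : R) : \bar R :=
  \big[mine/+oo]_(a <- alpha) ((x - a) ^+ 2)%:E.

Definition distortion Q alpha : \bar R := \int[Q]_x sq_dist alpha x.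

Definition quantization_error Q (n : nat) : \bar R :=
  ereal_inf [set distortion Q alpha | alpha in
    [set alpha : {fset R} | (1 <= #|` alpha| <= n)%N]].

Definition optimal_means Q (n : nat) alpha : Prop :=
  (1 <= #|` alpha| <= n)%N /\ distortion Q alpha = quantization_error Q n.

End quantization.

Section mixed_distribution.
Context (R : realType).

Lemma half_gt0 : 0 < 2^-1 :> R.
Proof. by rewrite invr_gt0 ltr0n. Qed.

Definition P1 : set (measurableTypeR R) -> \bar R := uniform_prob half_gt0.

HB.instance Definition _ := Probability.on P1.

Definition D : seq R := [:: 2 / 3; 5 / 6; 1].

Definition P2 : set (measurableTypeR R) -> \bar R :=
  mscale (3^-1)%:nng (msum (fun k => \d_(nth 0 D k : measurableTypeR R)) 3).

HB.instance Definition _ := Measure.on P2.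

Let P2_setT : P2 setT = 1%E.
Proof.
rewrite /P2 /mscale /= /msum !big_ord_recl big_ord0 /= !diracT adde0.
by rewrite -!EFinD -EFinM; congr EFin; rewrite -[X in _ * X]/(3%:R) mulVf.
Qed.

HB.instance Definition _ := Measure_isProbability.Build _ _ _ P2 P2_setT.

Definition P : set (measurableTypeR R) -> \bar R :=
  measure_add (mscale (2^-1)%:nng P1) (mscale (2^-1)%:nng P2).

HB.instance Definition _ := Measure.on P.

Let P_setT : P setT = 1%E.
Proof.
rewrite /P measure_addE /mscale [X in (_ * X + _)%E](probability_setT P1).
rewrite [X in (_ + _ * X)%E]P2_setT !mule1 -EFinD.
by congr EFin; rewrite /= -mulr2n -mulr_natr mulVf.
Qed.

HB.instance Definition _ := Measure_isProbability.Build _ _ _ P P_setT.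

End mixed_distribution.

Arguments P1 R : clear implicits.
Arguments P2 R : clear implicits.
Arguments P R : clear implicits.

(* Main.v *)
(** Write [h = 1/8] and let [f] be the squared distance to the set of centres.
    Since [h^2 - f] is at most the sum over the centres [b] of
    [max(0, h^2 - (x - b)^2)], integrating over [[0, 1/2]] bounds the uniform
    part below by [h^2/2] minus one mass per centre, each at most
    [4h^3/3 = 1/384].  If the points of [D] have distinct nearest centres, the
    mass of such a centre is at most the cost it leaves at its point of [D],
    with equality only when the two coincide, so the two remaining centres give
    [1/128 - 2/384 = 1/384].  Otherwise two points of [D] share a centre and
    the discrete part alone costs at least [1/432]. *)
Require Import Defs.
From mathcomp Require Import all_boot all_order all_algebra finmap.
From mathcomp Require Import all_classical all_reals all_analysis.
From mathcomp Require Import measurable_realfun ring lra.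

Set Implicit Arguments.
Unset Strict Implicit.
Unset Printing Implicit Defensive.

Import Order.TTheory GRing.Theory Num.Theory.
Import numFieldNormedType.Exports.

Local Open Scope classical_set_scope.
Local Open Scope fset_scope.
Local Open Scope ring_scope.

(** * Integrals of quadratics over a segment *)

Section quadratic_integrals.
Context {R : realType}.
Implicit Types (a b c h p q x : R).

Lemma integral_quadratic A B b p q : p <= q ->
  (\int[lebesgue_measure]_(x in `[p, q]) (A + B * (x - b) ^+ 2)%:E =
   (A * (q - p) + B * ((q - b) ^+ 3 - (p - b) ^+ 3) / 3)%:E)%E.
Proof.
(* The fundamental theorem of calculus used below needs [p < q]. *)
rewrite le_eqVlt => /predU1P[<-|pq].
  rewrite set_itv1 integral_set1; congr EFin.
  by rewrite !subrr !(mulr0, mul0r) addr0.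
pose F x := A * x + B * ((x - b) ^+ 3 / 3).
have dF x : is_derive x 1 F (A + B * (x - b) ^+ 2).
  rewrite /F; apply: is_derive_eq.
  rewrite /GRing.scale /= !mulr0 add0r !subr0 !mulr1; congr (_ + B * _).
  by field.
have cF : continuous F.
  move=> y; apply/differentiable_continuous/derivable1_diffP.
  exact: (@ex_derive _ _ _ _ _ _ _ (dF y)).
rewrite (@continuous_FTC2 _ _ F) //.
- by rewrite -EFinD; congr EFin; rewrite /F; field.
- apply: continuous_subspaceT => y.
  apply: cvgD; first exact: cvg_cst.
  apply: cvgM; first exact: cvg_cst.
  by rewrite /continuous_at expr2; apply: cvgM; apply: cvgB;
    (exact: cvg_id || exact: cvg_cst).
- split.
  + by move=> x _; apply: (@ex_derive _ _ _ _ _ _ _ (dF x)).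
  + exact/cvg_at_right_filter/cF.
  + exact/cvg_at_left_filter/cF.
- by move=> x _; rewrite derive1E; apply: derive_val.
Qed.

End quadratic_integrals.

(** * The squared distance to a finite set and the distortion of [P] *)

Section squared_distance.
Context {R : realType}.
Implicit Types (alpha : {fset R}) (x : R).

Lemma sq_dist_ge0 alpha x : (0 <= sq_dist alpha x)%E.
Proof.
rewrite /sq_dist; elim/big_ind: _ => [|u v u0 v0|a _]; first exact: leey.
  by rewrite le_min u0.
by rewrite lee_fin sqr_ge0.
Qed.

Lemma measurable_sq_dist alpha :
  measurable_fun [set: R] (sq_dist alpha).
Proof.
rewrite /sq_dist; elim: (enum_fset alpha) => [|a s ih].
  by under eq_fun do rewrite big_nil; exact: measurable_cst.
under eq_fun do rewrite big_cons.
apply: measurable_mine => //.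
apply/measurable_EFinP; apply: measurable_funX.
by apply: measurable_funB; [exact: measurable_id|exact: measurable_cst].
Qed.

Lemma sq_dist_le alpha a x : a \in alpha -> (sq_dist alpha x <= ((x - a) ^+ 2)%:E)%E.
Proof. by move=> ain; apply: (@bigmin_inf_seq _ _ _ _ _ a). Qed.

Lemma sq_dist_attained alpha x : alpha != fset0 ->
  exists2 a, a \in alpha & sq_dist alpha x = ((x - a) ^+ 2)%:E.
Proof.
move=> /fset0Pn[a0 a0in].
(* The neutral element [+oo] must be an alternative in the induction on the iterated minimum; an
   element of [alpha] rules it out afterwards. *)
have : sq_dist alpha x = +oo%E \/
    exists2 a, a \in alpha & sq_dist alpha x = ((x - a) ^+ 2)%:E.
  rewrite /sq_dist big_seq.
  elim/big_ind: _ => [|u v hu hv|a ain]; [by left| |by right; exists a].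
  by case: (leP u v).
case=> // foo; have := sq_dist_le x a0in.
by rewrite foo leye_eq.
Qed.

(** The weight [1/2] of [P1] cancels the density 2 of the uniform law on [[0, 1/2]], and [6^-1] is
    [1/2 * 1/3]. *)
Lemma distortion_PE alpha :
  distortion (P R) alpha =
  (\int[lebesgue_measure]_(x in `[0%R, 2^-1%R]) sq_dist alpha x +
   (6^-1)%:E * (sq_dist alpha (2 / 3) + sq_dist alpha (5 / 6) + sq_dist alpha 1))%E.
Proof.
have mf := measurable_sq_dist alpha.
have f0 := sq_dist_ge0 alpha.
rewrite /distortion /P ge0_integral_measure_add //.
rewrite !ge0_integral_mscale //; congr (_ + _)%E.
  rewrite integral_uniform // muleA -EFinM subr0 invrK /=.
  by rewrite mulVf // mul1e.
rewrite ge0_integral_measure_sum // !big_ord_recl big_ord0 /= adde0.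
rewrite !integral_dirac // !diracT !mul1e muleA -EFinM addeA.
by congr (_ * _)%E; congr EFin; rewrite /=; field.
Qed.

End squared_distance.

(** * Bounding an integral below by cell masses *)

Section cells.
Context {R : realType}.
Implicit Types (b h p q x L : R).

(** Closed form of the integral of [h ^+ 2 - (x - b) ^+ 2] over [[p, q]], with value 0 on an empty
    interval. *)
Definition cell_mass h b p q : R :=
  if p <= q then h ^+ 2 * (q - p) - ((q - b) ^+ 3 - (p - b) ^+ 3) / 3 else 0.

Definition cell_gain h b p q : R -> \bar R :=
  (fun x => (h ^+ 2 - (x - b) ^+ 2)%:E) \_ `[p, q].

Lemma cell_gain_ge0 h b p q x : b - h <= p -> q <= b + h ->
  (0 <= cell_gain h b p q x)%E.
Proof.
move=> hp hq; rewrite /cell_gain patchE; case: ifPn => //.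
rewrite inE /= in_itv /= => /andP[px xq]; rewrite lee_fin.
have : 0 <= (h - (x - b)) * (h + (x - b)) by apply: mulr_ge0; lra.
lra.
Qed.

Lemma measurable_cell_gain h b p q :
  measurable_fun [set: R] (cell_gain h b p q).
Proof.
apply/(measurable_restrictT _ _).1 => //.
apply/measurable_EFinP; apply: measurable_funB; first exact: measurable_cst.
apply: measurable_funX.
by apply: measurable_funB; [exact: measurable_id|exact: measurable_cst].
Qed.

Lemma integral_cell_gain h b p q :
  (\int[lebesgue_measure]_x cell_gain h b p q x = (cell_mass h b p q)%:E)%E.
Proof.
rewrite /cell_gain -integral_mkcond /cell_mass; case: ifPn => pq.
  under eq_integral do rewrite -mulN1r.
  by rewrite integral_quadratic //; congr EFin; field.
by rewrite set_itv_ge ?integral_set0 // bnd_simp.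
Qed.

(** A triple [(b, p, q)] is a centre with its cell. Pointwise, [h ^+ 2] is at most [g] plus the sum
    of the gains: where [g < h ^+ 2], one cell supplies the deficit and the other gains are
    nonnegative. Hence cells may overlap or leave [[0, L]]. *)
Lemma integral_ge_cells L h (g : R -> \bar R) (cells : seq (R * R * R)) :
  0 <= L -> measurable_fun [set: R] g -> (forall x, (0 <= g x)%E) ->
  {in cells, forall c, c.1.1 - h <= c.1.2 /\ c.2 <= c.1.1 + h} ->
  (forall x, 0 <= x <= L -> ((h ^+ 2)%:E <= g x)%E \/
     exists2 c, c \in cells & c.1.2 <= x <= c.2 /\ (((x - c.1.1) ^+ 2)%:E <= g x)%E) ->
  ((L * h ^+ 2 - \sum_(c <- cells) cell_mass h c.1.1 c.1.2 c.2)%:E <=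
   \int[lebesgue_measure]_(x in `[0%R, L]) g x)%E.
Proof.
move=> L0 mg g0 hcells hcov.
(* Setting the gain to 0 off [cells] makes it nonnegative for every [c], so that the summation
   lemmas apply. *)
pose gain c x := if c \in cells then cell_gain h c.1.1 c.1.2 c.2 x else 0%E.
have gain0 c x : (0 <= gain c x)%E.
  by rewrite /gain; case: ifPn => // /hcells[? ?]; exact: cell_gain_ge0.
have mgain c : measurable_fun [set: R] (gain c).
  rewrite /gain; case: (c \in cells); first exact: measurable_cell_gain.
  exact: measurable_cst.
have msum : measurable_fun [set: R] (fun x => \sum_(c <- cells) gain c x)%E.
  by apply: emeasurable_sum => c; exact: mgain.
rewrite EFinB leeBlDr //.
have -> : (L * h ^+ 2)%:E =
    (\int[lebesgue_measure]_(x in `[0%R, L]) (cst (h ^+ 2)%:E) x)%E.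
  rewrite integral_cst //= lebesgue_measure_itv /= lte_fin.
  case: ifPn => [_|]; first by rewrite -EFinB -EFinM subr0 mulrC.
  by rewrite -leNgt => L0'; rewrite (@le_anti _ _ L 0) ?L0' // mul0r mule0.
apply: (@le_trans _ _ (\int[lebesgue_measure]_(x in `[0%R, L])
    (g x + \sum_(c <- cells) gain c x))%E).
  apply: ge0_le_integral => //=.
  - by move=> x _; rewrite lee_fin sqr_ge0.
  - by apply: measurable_funTS; exact: emeasurable_funD.
  - move=> x; rewrite in_itv /= => /hcov[hg|[c cin [cx hg]]].
      by rewrite (le_trans hg) // leeDl // sume_ge0.
    rewrite -[h ^+ 2](subrK ((x - c.1.1) ^+ 2)) addrC EFinD leeD //.
    rewrite (big_rem c) //= -[leLHS]adde0; apply: leeD.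
      by rewrite /gain cin /cell_gain patchE mem_set //= in_itv.
    by apply: sume_ge0.
rewrite ge0_integralD //=; last 3 first.
- exact: measurable_funTS.
- by move=> x _; rewrite sume_ge0.
- exact: measurable_funTS.
rewrite leeD2l // ge0_integral_sum //=; last first.
  by move=> c; apply: (@measurable_funTS _ _ _ _ _ (gain c)) (mgain c).
rewrite -sumEFin big_seq [leRHS]big_seq; apply: lee_sum => c cin.
have gainE : gain c = cell_gain h c.1.1 c.1.2 c.2.
  by apply/funext => x; rewrite /gain cin.
rewrite -integral_cell_gain -gainE; apply: ge0_subset_integral => //.
by rewrite gainE; exact: measurable_cell_gain.
Qed.

End cells.

(** * Bounds on the mass of one cell *)

Section cell_mass_bounds.
Context {R : realType}.
Implicit Types (b h p q L d : R).

(** With [u = q - b], the product [(h - u)^2 (u + 2h) = 2h^3 - 3h^2 u + u^3] is nonnegative, which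
    bounds the right end's share by [2h^3/3]; the left end is symmetric. *)
Lemma cell_mass_le h b p q : 0 <= h -> b - h <= p -> q <= b + h ->
  cell_mass h b p q <= 4 / 3 * h ^+ 3.
Proof.
move=> h0 hp hq; rewrite /cell_mass; case: ifPn => [pq|_]; last first.
  by apply: mulr_ge0; [lra|exact: exprn_ge0].
have : 0 <= (h - (q - b)) ^+ 2 * (q - b + 2 * h).
  by apply: mulr_ge0; [exact: sqr_ge0|lra].
have : 0 <= (h + (p - b)) ^+ 2 * (2 * h - (p - b)).
  by apply: mulr_ge0; [exact: sqr_ge0|lra].
lra.
Qed.

(** Equality makes both products vanish; their other roots [-2h] and [2h] lie outside the reach. *)
Lemma cell_mass_max h b p q : 0 < h -> b - h <= p -> q <= b + h ->
  4 / 3 * h ^+ 3 <= cell_mass h b p q -> p = b - h /\ q = b + h.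
Proof.
move=> h0 hp hq; rewrite /cell_mass; case: ifPn => [pq|_] hm; last first.
  by have := exprn_gt0 3 h0; lra.
have hq0 : 0 <= (h - (q - b)) ^+ 2 * (q - b + 2 * h).
  by apply: mulr_ge0; [exact: sqr_ge0|lra].
have hp0 : 0 <= (h + (p - b)) ^+ 2 * (2 * h - (p - b)).
  by apply: mulr_ge0; [exact: sqr_ge0|lra].
have /eqP : (h - (q - b)) ^+ 2 * (q - b + 2 * h) = 0 by lra.
have /eqP : (h + (p - b)) ^+ 2 * (2 * h - (p - b)) = 0 by lra.
rewrite !mulf_eq0 !orbb => /orP[/eqP ?|/eqP ?] /orP[/eqP ?|/eqP ?]; lra.
Qed.

(** With [v = q - b + h], the mass is at most [h v^2 - v^3/3], and [0 <= v <= L - b + h]. *)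
Lemma cell_mass_le_sqr h b p q L : 0 <= h -> b - h <= p -> q <= b + h -> q <= L ->
  cell_mass h b p q <= h * (L - b + h) ^+ 2.
Proof.
move=> h0 hp hq hL; rewrite /cell_mass; case: ifPn => [pq|_]; last first.
  by apply: mulr_ge0 => //; exact: sqr_ge0.
have : 0 <= (h + (p - b)) ^+ 2 * (2 * h - (p - b)).
  by apply: mulr_ge0; [exact: sqr_ge0|lra].
have : 0 <= (q - b + h) ^+ 3 by apply: exprn_ge0; lra.
have : h * (q - b + h) ^+ 2 <= h * (L - b + h) ^+ 2.
  by apply: ler_wpM2l => //; rewrite ler_sqr ?nnegrE; lra.
lra.
Qed.

Definition reach_mass h b := cell_mass h b (Num.max 0 (b - h)) (Num.min 2^-1 (b + h)).

Lemma reach_mass_le h b : 0 <= h -> reach_mass h b <= 4 / 3 * h ^+ 3.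
Proof. by move=> h0; apply: cell_mass_le; rewrite ?le_max ?ge_min ?lexx ?orbT. Qed.

Lemma reach_mass_far h b : 2^-1 + h <= b -> reach_mass h b = 0.
Proof.
move=> hb; rewrite /reach_mass /cell_mass; case: ifPn => // hpq.
set p := Num.max _ _ in hpq *; set q := Num.min _ _ in hpq *.
have hp : b - h <= p by rewrite le_max lexx orbT.
have hq : q <= 2^-1 by rewrite ge_min lexx.
have -> : q = p by lra.
by rewrite !subrr; ring.
Qed.

(** From [5/8 = 1/2 + 1/8] on, the mass is 0. Below, with [v = 5/8 - b], it is at most [v^2/8],
    while the cost is at least [(v + 1/24)^2/6] because [2/3 = 5/8 + 1/24]. *)
Lemma reach_mass_le_cost b d : 2 / 3 <= d -> reach_mass (1 / 8) b <= (d - b) ^+ 2 / 6.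
Proof.
move=> hd; have [hb|hb] := leP (5 / 8) b.
  by rewrite reach_mass_far; [have := sqr_ge0 (d - b); lra|lra].
apply: (@le_trans _ _ (1 / 8 * (2^-1 - b + 1 / 8) ^+ 2)).
  by apply: cell_mass_le_sqr; rewrite ?le_max ?ge_min ?lexx ?orbT //; lra.
have : (2^-1 - b + 1 / 8 + 1 / 24) ^+ 2 <= (d - b) ^+ 2.
  by rewrite ler_sqr ?nnegrE; lra.
have : 0 <= (2^-1 - b + 1 / 8) ^+ 2 by exact: sqr_ge0.
nra.
Qed.

(** For [b < 5/8] the comparison of [v^2/8] with [(v + 1/24)^2/6] is strict; otherwise the mass is 0
    and so is the cost. *)
Lemma reach_mass_eq_cost b d : 2 / 3 <= d ->
  (d - b) ^+ 2 / 6 <= reach_mass (1 / 8) b -> b = d.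
Proof.
move=> hd; have [hb|hb] := leP (5 / 8) b.
  rewrite reach_mass_far; last lra.
  move=> h; have /eqP : (d - b) ^+ 2 = 0 by have := sqr_ge0 (d - b); lra.
  by rewrite expf_eq0 /= => /eqP; lra.
have : reach_mass (1 / 8) b <= 1 / 8 * (2^-1 - b + 1 / 8) ^+ 2.
  by apply: cell_mass_le_sqr; rewrite ?le_max ?ge_min ?lexx ?orbT //; lra.
have : (2^-1 - b + 1 / 8 + 1 / 24) ^+ 2 <= (d - b) ^+ 2.
  by rewrite ler_sqr ?nnegrE; lra.
have : 0 <= (2^-1 - b + 1 / 8) ^+ 2 by exact: sqr_ge0.
nra.
Qed.

End cell_mass_bounds.

(** * Lower bound for the uniform part *)

Section lower_bounds.
Context {R : realType}.
Implicit Types (alpha : {fset R}) (h b x : R).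

Lemma integral_sq_dist_ge alpha h : 0 <= h -> alpha != fset0 ->
  ((2^-1 * h ^+ 2 - \sum_(b <- alpha) reach_mass h b)%:E <=
   \int[lebesgue_measure]_(x in `[0%R, 2^-1%R]) sq_dist alpha x)%E.
Proof.
move=> h0 a0.
pose cells := [seq (b, Num.max 0 (b - h), Num.min 2^-1 (b + h)) | b <- enum_fset alpha].
rewrite [X in (2^-1 * _ - X)](_ : _ = \sum_(c <- cells) cell_mass h c.1.1 c.1.2 c.2); last first.
  by rewrite big_map.
apply: integral_ge_cells => //.
- exact: measurable_sq_dist.
- exact: sq_dist_ge0.
- by move=> _ /mapP[b _ ->] /=; rewrite !le_max !ge_min !lexx !orbT.
- move=> x /andP[x0 xL]; have [a ain ->] := sq_dist_attained x a0.
  have [|hx] := leP (h ^+ 2) ((x - a) ^+ 2); first by left; rewrite lee_fin.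
  right; exists (a, Num.max 0 (a - h), Num.min 2^-1 (a + h)).
    by apply/mapP; exists a.
  split => //=; rewrite ge_max le_min x0 xL /=.
  have : `|x - a| < h by rewrite -ltr_sqr ?nnegrE // real_normK ?num_real.
  by rewrite ltr_norml => /andP[? ?]; apply/andP; split; lra.
Qed.

End lower_bounds.

(** * The optimal set and its uniqueness *)

Section optimality.
Context {R : realType}.
Implicit Types (alpha : {fset R}) (a b d x : R).

Let opt : {fset R} := [fset 1 / 8; 3 / 8; 2 / 3; 5 / 6; 1].

Lemma distortion_opt_le : (distortion (P R) opt <= (1 / 384)%:E)%E.
Proof.
have mf := @measurable_sq_dist R opt.
have m0 d : d \in opt -> (sq_dist opt d <= 0)%E.
  by move=> /(sq_dist_le d); rewrite subrr expr2 mul0r.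
rewrite distortion_PE -[leRHS]adde0; apply: leeD; last first.
  apply: mule_ge0_le0; first by rewrite lee_fin.
  by rewrite !adde_le0 // m0 // !inE eqxx ?orbT.
(* The cut [1/4] is the midpoint of [1/8] and [3/8]; each half costs at most [1/768]. *)
have -> : `[0, 2^-1]%classic = (`[0%R, 1 / 4] `|` `]1 / 4, 2^-1])%classic :> set R.
  by rewrite -itv_bndbnd_setU // bnd_simp; lra.
rewrite ge0_integral_setU //=; last 3 first.
- exact: measurable_funTS.
- by move=> x _; exact: sq_dist_ge0.
- by apply/disj_setPS => x [] /=; rewrite !in_itv /= => /andP[_ ?] /andP[? _]; lra.
rewrite integral_itv_obnd_cbnd; last exact: measurable_funTS.
have part b p q : b \in opt -> p <= q ->
    (\int[lebesgue_measure]_(x in `[p, q]) sq_dist opt x <=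
     (((q - b) ^+ 3 - (p - b) ^+ 3) / 3)%:E)%E.
  move=> bin pq.
  apply: (@le_trans _ _
    (\int[lebesgue_measure]_(x in `[p, q]) (0 + 1 * (x - b) ^+ 2)%:E)%E).
    apply: ge0_le_integral => //.
    - by move=> x _; exact: sq_dist_ge0.
    - exact: measurable_funTS.
    - apply: measurable_funTS; apply/measurable_EFinP.
      apply: measurable_funD; first exact: measurable_cst.
      apply: measurable_funM; first exact: measurable_cst.
      apply: measurable_funX.
      by apply: measurable_funB; [exact: measurable_id|exact: measurable_cst].
    - by move=> x _; rewrite add0r mul1r; exact: sq_dist_le.
  by rewrite integral_quadratic // mul0r add0r mul1r.
apply: le_trans (leeD (part (1 / 8) _ _ _ _) (part (3 / 8) _ _ _ _)) _.
- by rewrite !inE eqxx.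
- lra.
- by rewrite !inE eqxx orbT.
- lra.
by rewrite -EFinD lee_fin; lra.
Qed.

(* Two points of D with the same nearest centre already cost 1/432, and five
   centres cannot bring the uniform part below 1/2400. *)
Lemma distortion_shared_gt alpha a d d' :
  alpha != fset0 -> (#|` alpha| <= 5)%N -> 1 / 6 <= d' - d ->
  ((1 / 384)%:E < \int[lebesgue_measure]_(x in `[0%R, 2^-1%R]) sq_dist alpha x +
     ((d - a) ^+ 2 / 6 + (d' - a) ^+ 2 / 6)%:E)%E.
Proof.
move=> a0 card5 dd.
(* Five reaches of radius [1/20] have total length exactly [1/2]; each mass is at most [1/6000], and
   [1/800 - 1/1200 = 1/2400]. *)
have sum_le : \sum_(b <- alpha) reach_mass (1 / 20) b <= 1 / 1200.
  apply: (@le_trans _ _ (\sum_(b <- alpha) (1 / 6000))).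
    by apply: ler_sum => b _; apply: (le_trans (reach_mass_le _ _)); lra.
  rewrite big_const_seq count_predT iter_addr_0 -mulr_natr.
  have : (size (enum_fset alpha))%:R <= 5%:R :> R by rewrite ler_nat.
  lra.
apply: (@lt_le_trans _ _
  ((2^-1 * (1 / 20) ^+ 2 - \sum_(b <- alpha) reach_mass (1 / 20) b)%:E +
    ((d - a) ^+ 2 / 6 + (d' - a) ^+ 2 / 6)%:E)%E); last first.
  by rewrite leeD2r // integral_sq_dist_ge //; lra.
rewrite -EFinD lte_fin.
(* By the parallelogram identity the two squares sum to at least [(1/6)^2 / 2 = 1/72]. *)
have : (1 / 6) ^+ 2 <= (d' - d) ^+ 2 by rewrite ler_sqr ?nnegrE; lra.
have : 0 <= ((d' - a) + (d - a)) ^+ 2 by exact: sqr_ge0.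
nra.
Qed.

(* Cutting the reach of the two centres at their midpoint makes the cells
   disjoint, so each must have the full mass 1/384. *)
Lemma two_centres_unique alpha b1 b2 : alpha != fset0 -> b1 <= b2 ->
  (forall a, a \in alpha -> [\/ a = b1, a = b2 | 5 / 8 <= a]) ->
  (\int[lebesgue_measure]_(x in `[0%R, 2^-1%R]) sq_dist alpha x <=
   (1 / 384)%:E)%E ->
  b1 = 1 / 8 /\ b2 = 3 / 8.
Proof.
move=> a0 b12 hal hint.
pose m := (b1 + b2) / 2.
pose h : R := 1 / 8.
pose p1 := Num.max 0 (b1 - h); pose q1 := Num.min m (b1 + h).
pose p2 := Num.max m (b2 - h); pose q2 := Num.min 2^-1 (b2 + h).
have hp1 : b1 - h <= p1 by rewrite le_max lexx orbT.
have hq1 : q1 <= b1 + h by rewrite ge_min lexx orbT.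
have hp2 : b2 - h <= p2 by rewrite le_max lexx orbT.
have hq2 : q2 <= b2 + h by rewrite ge_min lexx orbT.
pose cells := [:: (b1, p1, q1); (b2, p2, q2)].
(* Given this bound, the masses sum to at least [1/128 - 1/384 = 2/384], so both are maximal and
   neither cell is cut: two full cells of length [1/4] then tile [[0, 1/2]]. *)
suff : ((2^-1 * h ^+ 2 - \sum_(c <- cells) cell_mass h c.1.1 c.1.2 c.2)%:E <=
    \int[lebesgue_measure]_(x in `[0%R, 2^-1%R]) sq_dist alpha x)%E.
  move=> /le_trans => /(_ _ hint).
  rewrite !big_cons big_nil /= lee_fin => hsum.
  have h0 : 0 < h by rewrite /h; lra.
  have m1 := cell_mass_le (ltW h0) hp1 hq1.
  have m2 := cell_mass_le (ltW h0) hp2 hq2.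
  have [] := cell_mass_max h0 hp1 hq1.
    by rewrite /h in hsum m1 m2 *; lra.
  have [] := cell_mass_max h0 hp2 hq2.
    by rewrite /h in hsum m1 m2 *; lra.
  have : 0 <= p1 by rewrite le_max lexx.
  have : q1 <= m by rewrite ge_min lexx.
  have : m <= p2 by rewrite le_max lexx.
  have : q2 <= 2^-1 by rewrite ge_min lexx.
  rewrite /m /h; lra.
apply: integral_ge_cells => //.
- exact: measurable_sq_dist.
- exact: sq_dist_ge0.
- by move=> c; rewrite !inE => /orP[|] /eqP -> /=.
- move=> x /andP[x0 xL]; have [a ain fx] := sq_dist_attained x a0.
  have [|hx] := leP (h ^+ 2) ((x - a) ^+ 2); first by left; rewrite fx lee_fin.
  right.
  have : `|x - a| < h by rewrite -ltr_sqr ?nnegrE // ?real_normK ?num_real //; rewrite /h; lra.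
  rewrite ltr_norml => /andP[xa1 xa2].
  (* A centre at or beyond [5/8] is at least [1/8] away from every point of [[0, 1/2]]. *)
  have hab : a = b1 \/ a = b2.
    by case: (hal a ain) => ?; [left|right|move: xa1 xa2; rewrite /h; lra].
  have [xm|mx] := leP x m.
    exists (b1, p1, q1); rewrite ?inE ?eqxx //=.
    have sq : (x - b1) ^+ 2 <= (x - a) ^+ 2.
      case: hab => ->; first exact: lexx.
      have : 0 <= (b2 - b1) * (m - x) by apply: mulr_ge0; lra.
      rewrite /m; lra.
    split; last by rewrite fx lee_fin.
    have : `|x - b1| < h.
      by rewrite -ltr_sqr ?nnegrE // ?real_normK ?num_real //; rewrite /h in hx *; lra.
    rewrite ltr_norml => /andP[? ?].
    by rewrite ge_max le_min x0 xm /=; apply/andP; split; lra.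
  exists (b2, p2, q2); rewrite ?inE ?eqxx ?orbT //=.
  have sq : (x - b2) ^+ 2 <= (x - a) ^+ 2.
    case: hab => ->; last exact: lexx.
    have : 0 <= (b2 - b1) * (x - m) by apply: mulr_ge0; lra.
    rewrite /m; lra.
  split; last by rewrite fx lee_fin.
  have : `|x - b2| < h.
    by rewrite -ltr_sqr ?nnegrE // ?real_normK ?num_real //; rewrite /h in hx *; lra.
  rewrite ltr_norml => /andP[? ?].
  by rewrite ge_max le_min (ltW mx) xL /=; apply/andP; split; lra.
Qed.

Lemma distortion_bound alpha : (1 <= #|` alpha| <= 5)%N ->
  ((1 / 384)%:E <= distortion (P R) alpha)%E /\
  ((distortion (P R) alpha <= (1 / 384)%:E)%E -> alpha = opt).
Proof.
move=> /andP[card1 card5].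
have a0 : alpha != fset0 by rewrite -cardfs_gt0.
have [c1 c1in f1] := sq_dist_attained (2 / 3) a0.
have [c2 c2in f2] := sq_dist_attained (5 / 6) a0.
have [c3 c3in f3] := sq_dist_attained 1 a0.
rewrite distortion_PE f1 f2 f3 -!EFinD -EFinM.
set I := (\int[_]_(_ in _) _)%E; set W := 6^-1 * _.
have s1 := sqr_ge0 (2 / 3 - c1).
have s2 := sqr_ge0 (5 / 6 - c2).
have s3 := sqr_ge0 (1 - c3).
(* A centre serving two points of [D] makes the bound strict, which settles both claims. *)
have shared a d d' : 1 / 6 <= d' - d -> (d - a) ^+ 2 / 6 + (d' - a) ^+ 2 / 6 <= W ->
    ((1 / 384)%:E <= I + W%:E)%E /\ ((I + W%:E <= (1 / 384)%:E)%E -> alpha = opt).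
  move=> dd dW.
  have lt : ((1 / 384)%:E < I + W%:E)%E.
    apply: (lt_le_trans (distortion_shared_gt a a0 card5 dd)).
    by rewrite leeD2l // lee_fin.
  by split; [exact: ltW|rewrite leNgt lt].
have [c12|c12] := eqVneq c1 c2.
  by apply: (shared c1 (2 / 3) (5 / 6)); [lra|rewrite /W -c12 in s2 *; lra].
have [c13|c13] := eqVneq c1 c3.
  by apply: (shared c1 (2 / 3) 1); [lra|rewrite /W -c13 in s3 *; lra].
have [c23|c23] := eqVneq c2 c3.
  by apply: (shared c2 (5 / 6) 1); [lra|rewrite /W -c23 in s3 *; lra].
(* The list [r] holds the at most two centres left after removing those nearest to the points of
   [D]. *)
have [r pr] : exists r, perm_eq alpha [:: c1, c2, c3 & r].
  exists (rem c3 (rem c2 (rem c1 alpha))).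
  rewrite (perm_trans (perm_to_rem c1in)) // perm_cons.
  have c2in' : c2 \in rem c1 alpha by rewrite (rem_mem _ c2in) // eq_sym.
  rewrite (perm_trans (perm_to_rem c2in')) // perm_cons perm_to_rem //.
  by rewrite !rem_mem // eq_sym.
have sz : (size r <= 2)%N.
  by move: card5; rewrite (perm_size pr).
have u1 : reach_mass (1 / 8) c1 <= (2 / 3 - c1) ^+ 2 / 6 by apply: reach_mass_le_cost; lra.
have u2 : reach_mass (1 / 8) c2 <= (5 / 6 - c2) ^+ 2 / 6 by apply: reach_mass_le_cost; lra.
have u3 : reach_mass (1 / 8) c3 <= (1 - c3) ^+ 2 / 6 by apply: reach_mass_le_cost; lra.
have sum_le : \sum_(b <- r) reach_mass (1 / 8) b <= (size r)%:R / 384.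
  apply: (@le_trans _ _ (\sum_(b <- r) (1 / 384))).
    by apply: ler_sum => b _; apply: (le_trans (reach_mass_le _ _)); lra.
  by rewrite big_const_seq count_predT iter_addr_0 -mulr_natl; lra.
have szR : (size r)%:R <= 2%:R :> R by rewrite ler_nat.
have : ((2^-1 * (1 / 8) ^+ 2 - \sum_(b <- alpha) reach_mass (1 / 8) b)%:E <= I)%E.
  by apply: integral_sq_dist_ge => //; lra.
rewrite (perm_big _ pr) /= !big_cons => hI.
have hV : ((2^-1 * (1 / 8) ^+ 2 - (reach_mass (1 / 8) c1 + (reach_mass (1 / 8) c2 +
    (reach_mass (1 / 8) c3 + \sum_(b <- r) reach_mass (1 / 8) b))) + W)%:E <= I + W%:E)%E.
  by rewrite EFinD leeD2r.
split; first by apply: le_trans hV; rewrite lee_fin /W; lra.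
move=> hle; have := le_trans hV hle; rewrite lee_fin => hreal.
(* Since [1/128 - 2/384 = 1/384] leaves no slack, each cost equals the corresponding mass. *)
have c1E : c1 = 2 / 3 by apply: reach_mass_eq_cost; rewrite /W in hreal; lra.
have c2E : c2 = 5 / 6 by apply: reach_mass_eq_cost; rewrite /W in hreal; lra.
have c3E : c3 = 1 by apply: reach_mass_eq_cost; rewrite /W in hreal; lra.
(* With at most one centre left, the bound would be at least [1/128 - 1/384 > 1/384]. *)
have sz2 : size r = 2%N.
  apply/eqP; rewrite eqn_leq sz /= leqNgt; apply/negP => szlt.
  have : (size r)%:R <= 1%:R :> R by rewrite ler_nat.
  by rewrite /W in hreal; lra.
have hint : (I <= (1 / 384)%:E)%E.
  by apply: le_trans hle; rewrite leeDl // lee_fin /W; lra.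
case: r sz2 pr {sz sum_le szR hI hV hreal} => [|b1 [|b2 []]] //= _ pr.
have memE a : (a \in alpha) = (a \in [:: c1; c2; c3; b1; b2]) by exact: perm_mem pr a.
suff bE : (b1 = 1 / 8 /\ b2 = 3 / 8) \/ (b2 = 1 / 8 /\ b1 = 3 / 8).
  have mem5 (u v w y z a : R) : a \in [:: w; y; z; u; v] = (a \in [fset u; v; w; y; z]).
    by rewrite !inE; move: (a == u) (a == v) (a == w) (a == y) (a == z) => [] [] [] [] [].
  have mem5C (u v w y z a : R) : a \in [:: w; y; z; v; u] = (a \in [fset u; v; w; y; z]).
    by rewrite !inE; move: (a == u) (a == v) (a == w) (a == y) (a == z) => [] [] [] [] [].
  apply/fsetP => a; rewrite memE c1E c2E c3E.
  by case: bE => -[-> ->]; [exact: mem5|exact: mem5C].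
have far a : a \in [:: c1; c2; c3] -> 5 / 8 <= a.
  by rewrite !inE => /or3P[] /eqP ->; rewrite ?c1E ?c2E ?c3E; clear; lra.
have [b12|/ltW b21] := leP b1 b2; [left|right]; apply: (two_centres_unique a0) => // a.
  rewrite memE -[_ :: _]/([:: c1; c2; c3] ++ [:: b1; b2]) mem_cat => /orP[/far ?|].
    by apply: Or33.
  by rewrite !inE => /orP[] /eqP ->; [apply: Or31|apply: Or32].
rewrite memE -[_ :: _]/([:: c1; c2; c3] ++ [:: b1; b2]) mem_cat => /orP[/far ?|].
  by apply: Or33.
by rewrite !inE => /orP[] /eqP ->; [apply: Or32|apply: Or31].
Qed.

End optimality.

Theorem lemma2p6p4 (R : realType) :
  (forall alpha : {fset R},
     optimal_means (P R) 5 alpha ->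
     alpha = [fset 1 / 8; 3 / 8; 2 / 3; 5 / 6; 1])
  /\ quantization_error (P R) 5 = (1 / 384)%:E.
Proof.
have qE : quantization_error (P R) 5 = (1 / 384)%:E.
  apply/eqP; rewrite eq_le; apply/andP; split; last first.
    by apply: le_ereal_inf_tmp => _ [alpha /= /distortion_bound[? _] <-].
  apply: (le_trans _ distortion_opt_le); apply: ereal_inf_lbound.
  exists [fset 1 / 8; 3 / 8; 2 / 3; 5 / 6; 1] => //=.
  rewrite cardfs_gt0; apply/andP; split.
    by apply/fset0Pn; exists 1; rewrite !inE eqxx !orbT.
  (* Counting one element per union bounds the cardinal by 5 without comparing the points. *)
  have leU (A : {fset R}) x : (#|` A `|` [fset x]| <= #|` A|.+1)%N.
    by rewrite cardfsU cardfs1 addn1 leq_subr.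
  do 4 apply: (leq_trans (leU _ _)).
  by rewrite cardfs1.
split=> // alpha [hcard hopt].
by apply: (distortion_bound hcard).2; rewrite hopt qE.
Qed.
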